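(* Let $d_i(t)$ and $d'_i(t)$, $d''_i(t)$ ($i\in\mathbb Z$, $t\ge 0$) be the even-index and odd-index Fibonacci partition numbers defined in the context. Then for every integer $t\ge 1$: (1) $d'_i(t)=d_i(t)-d_{i-1}(t-1)$ for all $i\in\mathbb Z$; (2) $d''_i(t)=d_{i+1}(t)-d_{i+1}(t-1)$ for all $i\in\mathbb Z$; (3) $d_i(t-1)=d'_{i+1}(t)-d'_{i+1}(t-1)$ for all integers $i\le \frac{t-2}{2}$; (4) $d_i(t-1)=d''_i(t)-d''_{i-1}(t-1)$ for all integers $i\le \frac{t-2}{2}$; (5) $d_i(t-1)=d'_i(t)-d''_{i-2}(t-1)$ for all integers $i\le \frac{t}{2}$.
   Context: Even-index numbers: for integers $t\ge 0$ and $0\le i\le t/2$ define $d_i(t)$ recursively by $d_0(t)=1$ for all $t\ge0$; for $i\ge1$ and $2i<t$: $d_i(t)=2d_{i-1}(t-1)+d_i(t-1)-d_{i-1}(t-2)$; for $i\ge 1$: $d_i(2i)=3d_{i-1}(2i-1)-d_{i-1}(2i-2)$. Extend to all $i\in\mathbb Z$ by $d_i(t)=0$ for $i<0$ and $d_i(t)=d_{t-i}(t)$ for $i>t/2$ (so $d_i(t)=d_{t-i}(t)$ for all $i$, and $d_i(t)=0$ for $i>t$). Odd-index numbers: let $V$ be the set of pairs $(i,t)$ of integers with either $(i,t)=(0,0)$ or $0\le i\le t-1$. Define $d'_i(t)$ for $(i,t)\in V$ by: $d'_0(t)=1$ for all $t\ge 0$; $d'_{t-1}(t)=1$ for all $t\ge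 3$; for all other $(i,t)\in V$ (i.e. $1\le i\le t-2$, or $(i,t)=(1,2)$), recursively in $t$: if $2i\le t$ then $d'_i(t)=2d'_{i-1}(t-1)+d'_i(t-1)-d'_{i-1}(t-2)$, and if $2i\ge t+1$ then $d'_i(t)=d'_{i-1}(t-1)+2d'_i(t-1)-d'_{i-1}(t-2)$. Set $d'_i(t)=0$ for all integers $i$, $t\ge0$ with $(i,t)\notin V$, and define $d''_i(t)=d'_{t-1-i}(t)$ for all $i\in\mathbb Z$, $t\ge 0$ (so $d''_i(t)=0$ for $i<0$ except $d''_{-1}(0)=1$). For example, row $t=5$ of $d'$ reads $1,4,8,5,1$. *)

(* Defs.v *)
From Stdlib Require Import ZArith Bool.
Open Scope Z_scope.

(** The recursion for [d_i(t)] on its primary domain [0 <= 2 i <= t], which is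
    stable under the recursive calls; the values outside it are never used. *)
Fixpoint d_low (i : Z) (t : nat) {struct t} : Z :=
  if i =? 0 then 1 else
  match t with
  | S (S t2 as t1) =>
      if 2 * i <? Z.of_nat t
      then 2 * d_low (i - 1) t1 + d_low i t1 - d_low (i - 1) t2
      else 3 * d_low (i - 1) t1 - d_low (i - 1) t2
  | _ => 0
  end.

(** The case [t < i], where [t - i < 0], is set to [0] explicitly: it is the
    combination of [d_i(t) = d_{t-i}(t)] and [d_j(t) = 0] for [j < 0]. *)
Definition d (i : Z) (t : nat) : Z :=
  if (i <? 0) || (Z.of_nat t <? i) then 0
  else if 2 * i <=? Z.of_nat t then d_low i t
  else d_low (Z.of_nat t - i) t.

Definition inV (i : Z) (t : nat) : bool :=
  ((i =? 0) && (Z.of_nat t =? 0)) || ((0 <=? i) && (i <=? Z.of_nat t - 1)).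

(** The last branch of the [match] is unreachable: [inV i t] and [i <> 0] force
    [2 <= t]. *)
Fixpoint d' (i : Z) (t : nat) {struct t} : Z :=
  if negb (inV i t) then 0
  else if i =? 0 then 1
  else if (3 <=? Z.of_nat t) && (i =? Z.of_nat t - 1) then 1
  else
    match t with
    | S (S t2 as t1) =>
        if 2 * i <=? Z.of_nat t
        then 2 * d' (i - 1) t1 + d' i t1 - d' (i - 1) t2
        else d' (i - 1) t1 + 2 * d' i t1 - d' (i - 1) t2
    | _ => 0
    end.

Definition d'' (i : Z) (t : nat) : Z := d' (Z.of_nat t - 1 - i) t.

(* Main.v *)
(** The key point is that [d] satisfies
      [d_i(t) = 2 d_{i-1}(t-1) + d_i(t-1) - d_{i-1}(t-2)]  whenever [2 i <= t],
    including [2 i = t], where the symmetry [d_i(2i-1) = d_{i-1}(2i-1)] accounts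
    for the coefficient [3], and for every negative [i]; the symmetry
    [i -> t - i] gives the reflected recurrence for [2 i >= t].  Hence
    [d_i(t) - d_{i-1}(t-1)] obeys the recursion defining [d'_i(t)], which is (1);
    (2) is (1) read through the symmetry, and (3)-(5) become instances of the
    displayed recurrence once (1) and (2) are substituted. *)
Require Import Defs.
From Stdlib Require Import ZArith Bool Lia.
Open Scope Z_scope.

Lemma d_out (i : Z) (t : nat) : i < 0 \/ Z.of_nat t < i -> d i t = 0.
Proof.
  intros H; unfold d.
  destruct (Z.ltb_spec i 0), (Z.ltb_spec (Z.of_nat t) i); trivial; lia.
Qed.

Lemma d_d_low (i : Z) (t : nat) : 0 <= i -> 2 * i <= Z.of_nat t -> d i t = d_low i t.
Proof.
  intros H1 H2; unfold d.
  destruct (Z.ltb_spec i 0), (Z.ltb_spec (Z.of_nat t) i),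
    (Z.leb_spec (2 * i) (Z.of_nat t)); trivial; lia.
Qed.

(** Reflection swaps the two nonzero branches of [d], except at [2 * i = t], where [t - i = i]. *)
Lemma d_sym (i : Z) (t : nat) : d (Z.of_nat t - i) t = d i t.
Proof.
  unfold d.
  destruct (Z.ltb_spec (Z.of_nat t - i) 0), (Z.ltb_spec (Z.of_nat t) (Z.of_nat t - i)),
    (Z.ltb_spec i 0), (Z.ltb_spec (Z.of_nat t) i),
    (Z.leb_spec (2 * i) (Z.of_nat t)), (Z.leb_spec (2 * (Z.of_nat t - i)) (Z.of_nat t));
    cbn [orb]; trivial; try lia; f_equal; lia.
Qed.

Lemma d_0 (t : nat) : d 0 t = 1.
Proof. rewrite d_d_low by lia; now destruct t. Qed.

Lemma d_low_rec (i : Z) (n : nat) : i <> 0 ->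
  d_low i (S (S n)) =
    if 2 * i <? Z.of_nat (S (S n))
    then 2 * d_low (i - 1) (S n) + d_low i (S n) - d_low (i - 1) n
    else 3 * d_low (i - 1) (S n) - d_low (i - 1) n.
Proof.
  intros Hi; apply Z.eqb_neq in Hi.
  change (d_low i (S (S n))) with
    (if i =? 0 then 1 else
     if 2 * i <? Z.of_nat (S (S n))
     then 2 * d_low (i - 1) (S n) + d_low i (S n) - d_low (i - 1) n
     else 3 * d_low (i - 1) (S n) - d_low (i - 1) n).
  now rewrite Hi.
Qed.

Lemma d_rec_low (i : Z) (n : nat) : 2 * i <= Z.of_nat (S (S n)) ->
  d i (S (S n)) = 2 * d (i - 1) (S n) + d i (S n) - d (i - 1) n.
Proof.
  intros H.
  destruct (Z.lt_trichotomy i 0) as [Hi | [-> | Hi]].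
  - now rewrite !d_out by lia.
  - now rewrite !d_0, !d_out by lia.
  - rewrite (d_d_low i (S (S n))), d_low_rec by lia.
    rewrite (d_d_low (i - 1) (S n)), (d_d_low (i - 1) n) by lia.
    destruct (Z.ltb_spec (2 * i) (Z.of_nat (S (S n)))).
    + rewrite (d_d_low i (S n)) by lia; reflexivity.
    + rewrite <- (d_sym i (S n)).
      replace (Z.of_nat (S n) - i) with (i - 1) by lia.
      rewrite (d_d_low (i - 1) (S n)) by lia; lia.
Qed.

Lemma d_rec_high (i : Z) (n : nat) : Z.of_nat (S (S n)) <= 2 * i ->
  d i (S (S n)) = d (i - 1) (S n) + 2 * d i (S n) - d (i - 1) n.
Proof.
  intros H.
  rewrite <- (d_sym i (S (S n))), d_rec_low by lia.
  rewrite <- (d_sym (i - 1) (S n)), <- (d_sym i (S n)), <- (d_sym (i - 1) n).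
  replace (Z.of_nat (S (S n)) - i - 1) with (Z.of_nat (S n) - i) by lia.
  replace (Z.of_nat (S n) - (i - 1)) with (Z.of_nat (S (S n)) - i) by lia.
  replace (Z.of_nat n - (i - 1)) with (Z.of_nat (S n) - i) by lia.
  lia.
Qed.

(** The recurrence adds [2 - 1] at each step. Through [d_sym], this settles the prescribed entry
    [d'_{t-1}(t) = 1] as [t - (t - 1)]. *)
Lemma d_1 (n : nat) : d 1 (S n) = Z.of_nat (S n).
Proof.
  induction n as [| n IH]; [reflexivity |].
  rewrite d_rec_low, IH by lia; cbn [Z.sub Z.add Z.opp Z.pos_sub].
  rewrite !d_0; lia.
Qed.

Lemma inV_S (i : Z) (n : nat) : inV i (S n) = true <-> 0 <= i <= Z.of_nat n.
Proof.
  unfold inV.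
  destruct (Z.eqb_spec i 0), (Z.eqb_spec (Z.of_nat (S n)) 0),
    (Z.leb_spec 0 i), (Z.leb_spec i (Z.of_nat (S n) - 1)); cbn; intuition lia.
Qed.

Lemma d'_zero_index (i : Z) : i <> 0 -> d' i 0 = 0.
Proof.
  intros Hi; cbn; unfold inV.
  destruct (Z.eqb_spec i 0), (Z.leb_spec 0 i), (Z.leb_spec i (Z.of_nat 0 - 1));
    cbn in *; trivial; lia.
Qed.

Lemma d'_rec (i : Z) (n : nat) :
  d' i (S (S n)) =
    if negb (inV i (S (S n))) then 0
    else if i =? 0 then 1
    else if (3 <=? Z.of_nat (S (S n))) && (i =? Z.of_nat (S (S n)) - 1) then 1
    else if 2 * i <=? Z.of_nat (S (S n))
    then 2 * d' (i - 1) (S n) + d' i (S n) - d' (i - 1) n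
    else d' (i - 1) (S n) + 2 * d' i (S n) - d' (i - 1) n.
Proof. reflexivity. Qed.

Lemma d'_d (n : nat) : forall i : Z, d' i (S n) = d i (S n) - d (i - 1) n.
Proof.
  induction n as [n IH] using (well_founded_induction Nat.lt_wf_0); intros i.
  destruct (inV i (S n)) eqn:HV.
  2: { assert (Hd' : d' i (S n) = 0) by (cbn [d']; now rewrite HV).
       rewrite Hd'.
       assert (~ 0 <= i <= Z.of_nat n) by (rewrite <- inV_S, HV; discriminate).
       (* Outside [V] both terms vanish except at [i = t], where they are
          [d_t(t) = d_{t-1}(t-1) = 1] and cancel. *)
       destruct (Z.eq_dec i (Z.of_nat (S n))) as [-> |].
       - rewrite <- (d_sym _ (S n)), <- (d_sym _ n).
         replace (Z.of_nat (S n) - Z.of_nat (S n)) with 0 by lia.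
         replace (Z.of_nat n - (Z.of_nat (S n) - 1)) with 0 by lia.
         now rewrite !d_0.
       - now rewrite !d_out by lia. }
  destruct (Z.eq_dec i 0) as [-> | Hi].
  { rewrite d_0, d_out by lia; cbn [d']; now rewrite HV. }
  pose proof HV as Hr; apply inV_S in Hr.
  destruct n as [| [| n]]; [lia | | ].
  (* The pair [(1,2)] is computed directly: its recursion reaches row 0, which the induction
     hypothesis does not cover. *)
  { replace i with 1 by lia; reflexivity. }
  rewrite d'_rec, HV; cbn [negb].
  destruct (Z.eqb_spec i 0) as [| _]; [lia |].
  destruct (Z.leb_spec 3 (Z.of_nat (S (S (S n))))) as [_ |]; [| lia].
  cbn [andb].
  destruct (Z.eqb_spec i (Z.of_nat (S (S (S n))) - 1)) as [E | _].
  { rewrite <- (d_sym i), <- (d_sym (i - 1)).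
    replace (Z.of_nat (S (S (S n))) - i) with 1 by lia.
    replace (Z.of_nat (S (S n)) - (i - 1)) with 1 by lia.
    rewrite !d_1; lia. }
  rewrite !IH by lia.
  destruct (Z.leb_spec (2 * i) (Z.of_nat (S (S (S n))))).
  - rewrite (d_rec_low i (S n)), (d_rec_low (i - 1) n) by lia; lia.
  (* For the shifted term, [2 * (i - 1) >= t - 1] is exactly the branch condition
     [2 * i >= t + 1]. *)
  - rewrite (d_rec_high i (S n)), (d_rec_high (i - 1) n) by lia; lia.
Qed.

Lemma d''_d (n : nat) (i : Z) : d'' i (S n) = d (i + 1) (S n) - d (i + 1) n.
Proof.
  unfold d''; rewrite d'_d, <- (d_sym (i + 1) (S n)), <- (d_sym (i + 1) n).
  do 2 f_equal; lia.
Qed.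

Theorem mainTheorem1 (t : nat) (ht : (1 <= t)%nat) :
  (forall i : Z, d' i t = d i t - d (i - 1) (t - 1)%nat) /\
  (forall i : Z, d'' i t = d (i + 1) t - d (i + 1) (t - 1)%nat) /\
  (forall i : Z, 2 * i <= Z.of_nat t - 2 ->
     d i (t - 1)%nat = d' (i + 1) t - d' (i + 1) (t - 1)%nat) /\
  (forall i : Z, 2 * i <= Z.of_nat t - 2 ->
     d i (t - 1)%nat = d'' i t - d'' (i - 1) (t - 1)%nat) /\
  (forall i : Z, 2 * i <= Z.of_nat t ->
     d i (t - 1)%nat = d' i t - d'' (i - 2) (t - 1)%nat).
Proof.
  destruct t as [| n]; [lia |].
  replace (S n - 1)%nat with n by lia.
  split; [apply d'_d | split; [apply d''_d |]].
  destruct n as [| n].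
  - split; [| split]; intros i Hi.
    + rewrite d'_d; destruct (Z.eq_dec i (-1)) as [-> |]; [reflexivity |].
      rewrite d'_zero_index, !d_out by lia; reflexivity.
    + unfold d'' at 2; rewrite d''_d, d'_zero_index by lia.
      destruct (Z.eq_dec i (-1)) as [-> |]; [reflexivity |].
      rewrite !d_out by lia; reflexivity.
    + unfold d''; rewrite d'_d, d'_zero_index by lia.
      destruct (Z.eq_dec i 0) as [-> |]; [reflexivity |].
      rewrite !d_out by lia; reflexivity.
  (* (3) and (4) are the recurrence at index [i + 1], (5) at index [i]; each bound on [i] is exactly
     the range of [d_rec_low] there. *)
  - split; [| split]; intros i Hi.
    + pose proof (d_rec_low (i + 1) n) as H.
      rewrite !d'_d; rewrite Z.add_simpl_r in *; lia.
    + pose proof (d_rec_low (i + 1) n) as H.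
      rewrite !d''_d; rewrite Z.sub_simpl_r, Z.add_simpl_r in *; lia.
    + pose proof (d_rec_low i n) as H.
      rewrite d'_d, d''_d.
      replace (i - 2 + 1) with (i - 1) by lia; lia.
Qed.
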